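(* Let $F_0$ be a field of characteristic not $2$ and let $F=F_0(\sqrt b)$ be a quadratic field extension of $F_0$. Let $D_0=(L/F_0,\sigma,c)$ be an associative cyclic algebra over $F_0$ of degree $3$, and let $(F_0(\sqrt b)/F_0,\tau,d)$ be a nonassociative quaternion algebra. Let $d=d_0+\sqrt b\,d_1\in F\setminus F_0$ with $d_0,d_1\in F_0$. (i) If $3d_0^2+bd_1^2\ne0$, then $$(L/F_0,\sigma,c)\otimes_{F_0}(F_0(\sqrt b)/F_0,\tau,d)$$ is a division algebra over $F_0$. (ii) Let $F_0=\mathbb{Q}$. If $b>0$, or if $b<0$ and $-\frac b3\notin\mathbb{Q}^{\times2}$, then $$(L/F_0,\sigma,c)\otimes_{F_0}(F_0(\sqrt b)/F_0,\tau,d)$$ is a division algebra over $F_0$.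
   Context: Algebras are unital but not necessarily associative. A nonzero algebra $A$ is a division algebra if for every $x\ne0$ in $A$ the left and right multiplications by $x$ are bijective. Associative cyclic algebra: for a cyclic Galois extension $L/F_0$ of degree $n$ with $\mathrm{Gal}(L/F_0)=\langle\sigma\rangle$ and $c\in F_0^\times$, $(L/F_0,\sigma,c)=L\oplus eL\oplus\dots\oplus e^{n-1}L$ with $e^n=c$ and $le=e\sigma(l)$ for all $l\in L$ (here $n=3$). Here $\tau$ is the nontrivial automorphism of $F/F_0$, $\tau(\sqrt b)=-\sqrt b$. For $d\in F\setminus F_0$, the nonassociative quaternion algebra $(F/F_0,\tau,d)$ is $F\oplus eF$ with multiplication $(x+ey)(x'+ey')=\big(xx'+d\,\tau(y)y'\big)+e\big(\tau(x)y'+yx'\big)$ for $x,y,x',y'\in F$. $\mathbb{Q}^{\times2}$ denotes the set of squares of nonzero rational numbers.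
   Formalization: Both parts additionally assume that the cyclic algebra D_0=(L/F_0,σ,c) is a division algebra; without this the claim fails (c=1 gives D_0≅M_3(F_0)), and it is necessary since D_0 embeds in the tensor product. *)

(* Defs.v *)
From HB Require Import structures.
From mathcomp Require Import all_boot all_order all_algebra all_fingroup.
From mathcomp Require Import all_solvable all_field.
From mathcomp Require Import sesquilinear.

Set Implicit Arguments.
Unset Strict Implicit.
Unset Printing Implicit Defensive.

Import GRing.Theory.
Local Open Scope ring_scope.

(* Finite-dimensional unital algebras, with no associativity requirement. The *)
(* ring structures of MathComp are all associative, so that the product is    *)
(* kept separate from the ring multiplication of the carrier, if it has one.  *)
Record naAlg (F : fieldType) := NaAlg {
  na_sort :> vectType F;
  na_mul : na_sort -> na_sort -> na_sort;
  na_one : na_sort;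
  na_mul_bilinear : bilinear_for *:%R *:%R na_mul;
  na_mul1l : left_id na_one na_mul;
  na_mul1r : right_id na_one na_mul
}.

Definition is_division_alg (F : fieldType) (A : naAlg F) : Prop :=
  (exists x : A, x != 0) /\
  forall x : A, x != 0 ->
    bijective (fun y => na_mul x y) /\ bijective (fun y => na_mul y x).

(* U (x) V is the space of matrices of coordinates in the basis e_i (x) f_j,  *)
(* where e and f are the bases of U and V provided by vbasis. Its universal   *)
(* property is given by tens_lift_pure and tens_lift_unique.                  *)
Section TensorSpace.
Variables (F : fieldType) (U V : vectType F).

Definition tens_space : vectType F := 'M[F]_(\dim {:U}, \dim {:V}).

Definition tens_pure (u : U) (v : V) : tens_space := 
  \matrix_(i, j) (coord (vbasis {:U}) i u * coord (vbasis {:V}) j v).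

Definition tens_lift (W : lmodType F) (g : U -> V -> W) (t : tens_space) : W :=
  \sum_i \sum_j t i j *: g (vbasis {:U})`_i (vbasis {:V})`_j.

Lemma tens_pure_bilinear : bilinear_for *:%R *:%R tens_pure.
Proof.
split=> [v|u] a x y; apply/matrixP=> i j; rewrite !mxE linearP /=.
  by rewrite mulrDl mulrA.
by rewrite mulrDr mulrCA.
Qed.

Lemma tens_lift_linear (W : lmodType F) (g : U -> V -> W) :
  linear (tens_lift g).
Proof.
move=> a t t'; rewrite /tens_lift scaler_sumr -big_split; apply: eq_bigr => i _.
rewrite scaler_sumr -big_split; apply: eq_bigr => j _ /=.
by rewrite !mxE scalerDl scalerA.
Qed.

HB.instance Definition _ (W : lmodType F) (g : U -> V -> W) :=
  GRing.isLinear.Build F tens_space W *:%R (tens_lift g) (tens_lift_linear g).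

Lemma tens_liftP (W : lmodType F) (g g' : U -> V -> W) a t :
  tens_lift (fun u v => a *: g u v + g' u v) t =
  a *: tens_lift g t + tens_lift g' t.
Proof.
rewrite /tens_lift scaler_sumr -big_split; apply: eq_bigr => i _.
rewrite scaler_sumr -big_split; apply: eq_bigr => j _ /=.
by rewrite scalerDr !scalerA mulrC.
Qed.

Lemma tens_lift_pure (W : lmodType F) (g : U -> V -> W) (u : U) (v : V) :
  bilinear_for *:%R *:%R g -> tens_lift g (tens_pure u v) = g u v.
Proof.
case=> gl gr.
pose gL v := HB.pack_for {linear U -> W} (g ^~ v)
  (GRing.isLinear.Build _ _ _ _ _ (gl v)).
pose gR u := HB.pack_for {linear V -> W} (g u)
  (GRing.isLinear.Build _ _ _ _ _ (gr u)).
rewrite [u in RHS](coord_vbasis (memvf u)) [RHS](linear_sum (gL v)).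
apply: eq_bigr => i _; rewrite [RHS](linearZ_LR (gL v)) /=.
rewrite [v in RHS](coord_vbasis (memvf v)).
rewrite [X in _ = _ *: X](linear_sum (gR _)) scaler_sumr; apply: eq_bigr => j _.
by rewrite [X in _ = _ *: X](linearZ_LR (gR _)) /= scalerA mxE.
Qed.

Lemma tens_lift_unique (W : lmodType F) (f : {linear tens_space -> W}) :
  f =1 tens_lift (fun u v => f (tens_pure u v)).
Proof.
move=> t; rewrite [t in LHS]matrix_sum_delta linear_sum; apply: eq_bigr => i _.
rewrite linear_sum; apply: eq_bigr => j _; rewrite linearZ; congr (_ *: f _).
apply/matrixP=> k l; rewrite !mxE.
by rewrite !coord_free ?(basis_free (vbasisP _)) // -natrM mulnb !(eq_sym i, eq_sym j).
Qed.

Lemma tens_ind (W : lmodType F) (f g : {linear tens_space -> W}) :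
  (forall u v, f (tens_pure u v) = g (tens_pure u v)) -> f =1 g.
Proof.
move=> fg t; rewrite tens_lift_unique [RHS]tens_lift_unique.
by apply: eq_bigr => i _; apply: eq_bigr => j _; rewrite fg.
Qed.

End TensorSpace.

(* The product is the bilinear extension of                                   *)
(* (a (x) b) (a' (x) b') = (a a') (x) (b b'), see tens_mul_pure.              *)
Section TensorAlgebra.
Variables (F : fieldType) (A B : naAlg F).

Definition tens_mul (s t : tens_space A B) : tens_space A B :=
  tens_lift (fun a b =>
    tens_lift (fun a' b' => tens_pure (na_mul a a') (na_mul b b')) t) s.

Definition tens_one : tens_space A B := tens_pure (na_one A) (na_one B).

Lemma tens_mul_bilinear : bilinear_for *:%R *:%R tens_mul.
Proof.
split=> [t|s] a x y; first exact: tens_lift_linear.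
rewrite /tens_mul -tens_liftP; apply: eq_bigr => i _; apply: eq_bigr => j _.
by rewrite tens_lift_linear.
Qed.

Lemma tens_mul_pure (a a' : A) (b b' : B) :
  tens_mul (tens_pure a b) (tens_pure a' b') =
  tens_pure (na_mul a a') (na_mul b b').
Proof.
have [mAl mAr] := na_mul_bilinear A; have [mBl mBr] := na_mul_bilinear B.
have [pl pr] := tens_pure_bilinear A B.
rewrite /tens_mul tens_lift_pure; first rewrite tens_lift_pure //.
  by split=> [v|u] k x y /=; rewrite ?mAr ?mBr ?pl ?pr.
split=> [v|u] k x y; rewrite -tens_liftP;
  apply: eq_bigr => i _; apply: eq_bigr => j _;
  by rewrite ?mAl ?mBl ?pl ?pr.
Qed.

Lemma tens_mul1l : left_id tens_one tens_mul.
Proof.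
have [_ mr] := tens_mul_bilinear.
pose f := HB.pack_for {linear tens_space A B -> tens_space A B}
  (tens_mul tens_one) (GRing.isLinear.Build _ _ _ _ _ (mr tens_one)).
by apply: (@tens_ind _ _ _ _ f idfun) => u v /=; rewrite tens_mul_pure !na_mul1l.
Qed.

Lemma tens_mul1r : right_id tens_one tens_mul.
Proof.
have [ml _] := tens_mul_bilinear.
pose f := HB.pack_for {linear tens_space A B -> tens_space A B}
  (tens_mul ^~ tens_one) (GRing.isLinear.Build _ _ _ _ _ (ml tens_one)).
by apply: (@tens_ind _ _ _ _ f idfun) => u v /=; rewrite tens_mul_pure !na_mul1r.
Qed.

Definition tens_alg : naAlg F :=
  NaAlg tens_mul_bilinear tens_mul1l tens_mul1r.

End TensorAlgebra.

(* The algebra (L/F, sigma, c) of degree n: x : {ffun 'I_n -> L} stands for   *)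
(* \sum_i e^i (x i). The rules l e = e sigma(l) and e^n = c give              *)
(* (e^i l) (e^j m) = e^(i+j) sigma^j(l) m                                     *)
(* with e^(i+j) = c^((i+j) %/ n) e^((i+j) %% n). The index type is            *)
(* 'I_n.-1.+1, which is convertible to 'I_n for any numeral n > 0.            *)
Section CyclicAlgebra.
Variables (F : fieldType) (n : nat) (L : fieldExtType F).
Variables (sigma : 'AEnd(L)) (c : F).
Local Notation N := (n.-1.+1).

Definition cyclic_mul (x y : {ffun 'I_N -> L}) : {ffun 'I_N -> L} :=
  [ffun k : 'I_N => \sum_(i < N) \sum_(j < N | ((i + j) %% N == k)%N)
     c ^+ ((i + j) %/ N)%N *: (iter j sigma (x i) * y j)].

Definition cyclic_one : {ffun 'I_N -> L} := [ffun k => (k == ord0)%:R].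

Lemma cyclic_mul_bilinear : bilinear_for *:%R *:%R cyclic_mul.
Proof.
have iterP j a (u v : L) :
    iter j sigma (a *: u + v) = a *: iter j sigma u + iter j sigma v.
  by elim: j => //= j ->; rewrite linearP.
split=> [z|z] a x y; apply/ffunP=> k; rewrite !ffunE scaler_sumr -big_split /=;
  apply: eq_bigr => i _; rewrite scaler_sumr -big_split /=;
  apply: eq_bigr => j _; rewrite !ffunE ?iterP.
  by rewrite mulrDl scalerDr -scalerAl !scalerA mulrC.
by rewrite mulrDr scalerDr -scalerAr !scalerA mulrC.
Qed.

Lemma cyclic_mul1l : left_id cyclic_one cyclic_mul.
Proof.
move=> x; apply/ffunP=> k; rewrite ffunE (bigD1 ord0) //= [X in _ + X]big1 => [|i ni0].
  rewrite addr0 (bigD1 k) /=; last by rewrite add0n modn_small.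
  rewrite [X in _ + X]big1 => [|j].
    rewrite addr0 add0n divn_small // expr0 scale1r ffunE eqxx.
    by rewrite (_ : iter k sigma 1 = 1) ?mul1r //; elim: (nat_of_ord k) => //= m ->; rewrite rmorph1.
  by rewrite add0n modn_small // val_eqE andbN.
apply: big1 => j _; rewrite ffunE (negPf ni0).
rewrite (_ : iter j sigma 0 = 0) ?mul0r ?scaler0 //.
by elim: (nat_of_ord j) => //= m ->; rewrite rmorph0.
Qed.

Lemma cyclic_mul1r : right_id cyclic_one cyclic_mul.
Proof.
move=> x; apply/ffunP=> k; rewrite ffunE (bigD1 k) //= [X in _ + X]big1 => [|i nik].
  rewrite addr0 (bigD1 ord0) /=; last by rewrite addn0 modn_small.
  rewrite [X in _ + X]big1 => [|j /andP[_ nj0]].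
    by rewrite addr0 addn0 divn_small // expr0 scale1r ffunE eqxx mulr1.
  by rewrite ffunE (negPf nj0) mulr0 scaler0.
apply: big1 => j; rewrite ffunE; case: (altP (j =P ord0)) => [->|]; last by rewrite mulr0 scaler0.
by rewrite addn0 modn_small // val_eqE (negPf nik).
Qed.

Definition cyclic_alg : naAlg F :=
  NaAlg cyclic_mul_bilinear cyclic_mul1l cyclic_mul1r.

End CyclicAlgebra.

(* The algebra (K/F, tau, d): the pair (x, y) stands for x + e y.             *)
Section QuaternionAlgebra.
Variables (F : fieldType) (K : fieldExtType F) (tau : 'AEnd(K)) (d : K).

Definition quat_mul (u v : K * K) : K * K :=
  (u.1 * v.1 + d * tau u.2 * v.2, tau u.1 * v.2 + u.2 * v.1).

Lemma quat_mul_bilinear : bilinear_for *:%R *:%R quat_mul.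
Proof.
by split=> [w|w] a x y; congr (_, _) => /=;
  rewrite ?linearP /= !(mulrDl, mulrDr) -?(scalerAl, scalerAr) scalerDr addrACA.
Qed.

Lemma quat_mul1l : left_id (1, 0) quat_mul.
Proof.
by case=> x y; rewrite /quat_mul /= rmorph0 rmorph1 mulr0 !mul0r !mul1r !addr0.
Qed.

Lemma quat_mul1r : right_id (1, 0) quat_mul.
Proof. by case=> x y; rewrite /quat_mul /= !mulr0 !mulr1 addr0 add0r. Qed.

Definition quaternion_alg : naAlg F :=
  NaAlg quat_mul_bilinear quat_mul1l quat_mul1r.

End QuaternionAlgebra.

(* Main.v *)
Require Import Defs.
From HB Require Import structures.
From mathcomp Require Import all_boot all_order all_algebra all_fingroup.
From mathcomp Require Import all_solvable all_field.
From mathcomp Require Import ring.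

Set Implicit Arguments.
Unset Strict Implicit.
Unset Printing Implicit Defensive.

Import Order.TTheory GRing.Theory Num.Theory.
Local Open Scope ring_scope.

(** Let D = D0 (x) F, with tau acting on the second factor.  The tensor product
    is D + e D with
      (x + e y) (x' + e y') = (x x' + d tau(y) y') + e (tau(x) y' + y x'),
    and being of finite dimension it is a division algebra as soon as it has no
    zero divisors.  If D has none, a product that vanishes for nonzero factors
    forces d = z tau(z) for some z in D.  The reduced norm N of D has degree 3,
    hence d^3 = N(z) tau(N(z)) lies in F0, whereas the coefficient of sqrt b in
    d^3 is d1 (3 d0^2 + b d1^2), which is not zero.  This gives the first
    claim.  The second follows from it, since over the rationals
    3 d0^2 + b d1^2 = 0 means - b/3 = (d0/d1)^2.

    The proof runs this argument on determinants, without inverses in D.  Left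
    multiplication of D0 on itself, a right L-module whose basis is formed by the
    powers of the generator of D0, is a multiplicative map to the 3 x 3 matrices
    over L ([lmul_mxM]).  With
    coefficients in M = L[s]/(s^2 - b), built as a ring of pairs, it represents
    D, so that an element of the tensor product becomes a pair of matrices over
    M that multiply by the formula above ([coef_mxM]).  Two determinants then
    play the role of the two components of each factor, and eliminating between
    them gives the contradiction ([quad_norm_elim], [tens_domain]).  Whether
    an element of M vanishes is tested by its norm to L, so that all cancellation
    takes place in L.

    That D has no zero divisors is the statement that the norm of the
    determinant of x + s y, for x and y in D0, vanishes only for x = y = 0
    ([det_norm_eq0]).  If y is not zero, then x = y w and
      (x + s y) (w - s) = y (w^2 - b),
    so it suffices that no w in D0 has square b.  Such a w would give
    det(w)^2 = b^3 and make b a square in L, which the odd degree of L excludes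
    ([nonsquare_cubic]). *)

(** * Division algebras and zero divisors *)

Lemma linear_inj_bij (F : fieldType) (V : vectType F) (f : {linear V -> V}) :
  (forall v, f v = 0 -> v = 0) -> bijective f.
Proof.
move=> f0; have kf : lker (linfun f) == 0%VS.
  by rewrite -subv0; apply/subvP=> v; rewrite memv_ker memv0 lfunE => /eqP/f0/eqP.
exists ((linfun f)^-1)%VF => v.
  by rewrite -[f v]lfunE lker0_lfunK.
by have := lker0_lfunVK kf v; rewrite lfunE.
Qed.

(** In finite dimension an injective multiplication is bijective. *)
Lemma division_alg_of_domain (F : fieldType) (A : naAlg F) :
  (exists x : A, x != 0) ->
  (forall x y : A, na_mul x y = 0 -> x = 0 \/ y = 0) -> is_division_alg A.
Proof.
move=> nzA dom; split=> // x /eqP nzx; have [ml mr] := na_mul_bilinear A.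
pose fl := HB.pack_for {linear A -> A} (na_mul x)
  (GRing.isLinear.Build _ _ _ _ _ (mr x)).
pose fr := HB.pack_for {linear A -> A} ((@na_mul F A)^~ x)
  (GRing.isLinear.Build _ _ _ _ _ (ml x)).
split; [apply: (@linear_inj_bij _ _ fl) | apply: (@linear_inj_bij _ _ fr)].
  by move=> v /dom[/nzx|].
by move=> v /dom[|/nzx].
Qed.

(** * Contraction of tensors *)

Section Contraction.
Variables (F : fieldType) (U V : vectType F).

Lemma tens_pureDl (u u' : U) (v : V) :
  tens_pure (u + u') v = tens_pure u v + tens_pure u' v.
Proof.
have [pl _] := tens_pure_bilinear U V.
by have /= := pl v 1 u u'; rewrite !scale1r.
Qed.

Lemma tens_pure0l (v : V) : tens_pure (0 : U) v = 0.
Proof. by apply: (addrI (tens_pure 0 v)); rewrite -tens_pureDl !addr0. Qed.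

Lemma tens_pureZl k (u : U) (v : V) :
  tens_pure (k *: u) v = k *: tens_pure u v.
Proof.
have [pl _] := tens_pure_bilinear U V.
by have /= := pl v k u 0; rewrite tens_pure0l !addr0.
Qed.

Lemma tens_pureDr (u : U) (v v' : V) :
  tens_pure u (v + v') = tens_pure u v + tens_pure u v'.
Proof.
have [_ pr] := tens_pure_bilinear U V.
by have /= := pr u 1 v v'; rewrite !scale1r.
Qed.

Lemma tens_pureZr k (u : U) (v : V) :
  tens_pure u (k *: v) = k *: tens_pure u v.
Proof.
have [_ pr] := tens_pure_bilinear U V.
have p0 : tens_pure u (0 : V) = 0.
  by apply: (addrI (tens_pure u 0)); rewrite -tens_pureDr !addr0.
by have /= := pr u k v 0; rewrite p0 !addr0.
Qed.

(** Sums of pure tensors suffice, as scalars are absorbed into pure tensors. *)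
Lemma tens_pure_ind (P : tens_space U V -> Prop) :
  (forall u v, P (tens_pure u v)) -> (forall s t, P s -> P t -> P (s + t)) ->
  forall t, P t.
Proof.
move=> Pp PD t; have P0 : P 0 by rewrite -(tens_pure0l 0).
have tE : t = tens_lift (@tens_pure F U V) t :=
  tens_lift_unique (HB.pack_for {linear tens_space U V -> tens_space U V}
    (@idfun (tens_space U V))) t.
rewrite tE; apply: big_ind => // i _; apply: big_ind => // j _.
by rewrite -tens_pureZl.
Qed.

(** Applying linear forms to the second factor reads off the coordinates of a
    tensor in a basis of V, with values in U. *)
Definition contraction (l : V -> F) : tens_space U V -> U :=
  tens_lift (fun u v => l v *: u).

Lemma contractionD l s t :
  contraction l (s + t) = contraction l s + contraction l t.
Proof. exact: linearD. Qed.

Lemma contraction_pure (l : {linear V -> F^o}) u v :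
  contraction l (tens_pure u v) = l v *: u.
Proof.
apply: tens_lift_pure; split=> [w|w] k x y.
  by rewrite /= scalerDr !scalerA [k * _]mulrC.
by rewrite /= linearP scalerDl scalerA.
Qed.

End Contraction.

(** * Quadratic extensions of commutative rings *)

(** The ring R[s]/(s^2 - b): the pair (x, y) stands for x + s y.  The parameter b
    does not occur in the carrier but selects the product. *)
Definition quadext (R : comNzRingType) (b : R) : Type := (R * R)%type.

Section QuadraticExtension.
Variables (R : comNzRingType) (b : R).
Local Notation M := (quadext b).

HB.instance Definition _ := GRing.Zmodule.copy M (R * R)%type.

Definition quadext_mul (u v : M) : M :=
  (u.1 * v.1 + b * (u.2 * v.2), u.1 * v.2 + u.2 * v.1).

Fact quadext_mulA : associative quadext_mul.
Proof. by move=> u v w; congr (_, _) => /=; ring. Qed.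
Fact quadext_mulC : commutative quadext_mul.
Proof. by move=> u v; congr (_, _) => /=; ring. Qed.
Fact quadext_mul1 : left_id ((1, 0) : M) quadext_mul.
Proof. by case=> u v; congr (_, _) => /=; ring. Qed.
Fact quadext_mulD : left_distributive quadext_mul +%R.
Proof. by move=> u v w; congr (_, _) => /=; ring. Qed.
Fact quadext_oner_neq0 : ((1, 0) : M) != 0.
Proof. by apply/eqP=> -[/eqP]; rewrite oner_eq0. Qed.

HB.instance Definition _ := GRing.Zmodule_isComNzRing.Build M
  quadext_mulA quadext_mulC quadext_mul1 quadext_mulD quadext_oner_neq0.

Lemma quadextM (u v : M) :
  u * v = (u.1 * v.1 + b * (u.2 * v.2), u.1 * v.2 + u.2 * v.1).
Proof. by []. Qed.

Definition quad_in (x : R) : M := (x, 0).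
Fact quad_in_is_zmod : zmod_morphism quad_in.
Proof. by move=> x y; congr (_, _) => /=; ring. Qed.
Fact quad_in_is_monoid : monoid_morphism quad_in.
Proof. by split=> // x y; rewrite quadextM; congr (_, _) => /=; ring. Qed.
HB.instance Definition _ := GRing.isZmodMorphism.Build R M quad_in quad_in_is_zmod.
HB.instance Definition _ := GRing.isMonoidMorphism.Build R M quad_in quad_in_is_monoid.

Definition quad_conj (u : M) : M := (u.1, - u.2).
Fact quad_conj_is_zmod : zmod_morphism quad_conj.
Proof. by move=> x y; congr (_, _) => /=; ring. Qed.
Fact quad_conj_is_monoid : monoid_morphism quad_conj.
Proof.
split=> [|x y]; first by congr (_, _); rewrite oppr0.
by rewrite !quadextM; congr (_, _) => /=; ring.
Qed.
HB.instance Definition _ := GRing.isZmodMorphism.Build M M quad_conj quad_conj_is_zmod.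
HB.instance Definition _ := GRing.isMonoidMorphism.Build M M quad_conj quad_conj_is_monoid.

Definition quad_norm (u : M) : R := u.1 ^+ 2 - b * u.2 ^+ 2.

Lemma quad_normM u v : quad_norm (u * v) = quad_norm u * quad_norm v.
Proof. by rewrite /quad_norm quadextM /=; ring. Qed.

Lemma quad_norm0 : quad_norm 0 = 0.
Proof. by rewrite /quad_norm /=; ring. Qed.

Lemma quad_norm_in x : quad_norm (quad_in x) = x ^+ 2.
Proof. by rewrite /quad_norm /=; ring. Qed.

Lemma quad_norm_conj u : quad_norm (quad_conj u) = quad_norm u.
Proof. by rewrite /quad_norm /= sqrrN. Qed.

Lemma mulr_quad_conj u : u * quad_conj u = quad_in (quad_norm u).
Proof. by rewrite quadextM; congr (_, _); rewrite /quad_norm /=; ring. Qed.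

(** If nu denotes the norm, eliminating x' gives y' (nu x - e nu y) = 0.  As
    nu x, nu y and nu y' lie in R, x no longer occurs in the coefficient of s of
    nu y' (nu x - e nu y). *)
Lemma quad_norm_elim (x x' y y' e : M) :
  x * x' = - e * (quad_conj y * y') -> quad_conj x * y' = - (y * x') ->
  quad_norm y * (quad_norm y' * e.2) = 0.
Proof.
move=> E1 E2.
have : quad_in (quad_norm y') *
       (quad_in (quad_norm x) - e * quad_in (quad_norm y)) = 0.
  rewrite -!mulr_quad_conj.
  transitivity (quad_conj y' * (x * (quad_conj x * y') - e * y * (quad_conj y * y'))).
    by ring.
  rewrite E2.
  transitivity (- (quad_conj y' * (y * (x * x' - - e * (quad_conj y * y'))))).
    by ring.
  by rewrite E1 subrr !mulr0 oppr0.
move=> /(congr1 snd); rewrite !quadextM /= !(mulr0, mul0r, add0r, addr0) mulrN.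
by move=> /(congr1 -%R); rewrite opprK oppr0 => <-; ring.
Qed.

(** The matrix P + s Q. *)
Definition quad_mx m n (P Q : 'M[R]_(m, n)) : 'M[M]_(m, n) :=
  \matrix_(i, j) ((P i j, Q i j) : M).

Lemma mul_quad_mx m n p (P Q : 'M[R]_(m, n)) (P' Q' : 'M[R]_(n, p)) :
  quad_mx P Q *m quad_mx P' Q' =
  quad_mx (P *m P' + b *: (Q *m Q')) (P *m Q' + Q *m P').
Proof.
apply/matrixP=> i k; rewrite !mxE mulr_sumr -!big_split /=.
apply: (big_rec3 (fun u v w => w = (u, v) :> M)) => // j u v w _ ->.
by rewrite !mxE quadextM.
Qed.

Lemma quad_mx_in m n (P : 'M[R]_(m, n)) : quad_mx P 0 = map_mx quad_in P.
Proof. by apply/matrixP=> i j; rewrite !mxE. Qed.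

Lemma quad_mxD m n (P Q P' Q' : 'M[R]_(m, n)) :
  quad_mx (P + P') (Q + Q') = quad_mx P Q + quad_mx P' Q'.
Proof. by apply/matrixP=> i j; rewrite !mxE. Qed.

Definition det_norm n (X : 'M[M]_n) : R := quad_norm (\det X).

Lemma det_norm_mul n (X Y : 'M[M]_n) : det_norm (X *m Y) = det_norm X * det_norm Y.
Proof. by rewrite /det_norm det_mulmx quad_normM. Qed.

Lemma det_norm_in n (P : 'M[R]_n) : det_norm (quad_mx P 0) = (\det P) ^+ 2.
Proof. by rewrite quad_mx_in /det_norm det_map_mx quad_norm_in. Qed.

Lemma det_norm_conj n (X : 'M[M]_n) : det_norm (map_mx quad_conj X) = det_norm X.
Proof. by rewrite /det_norm det_map_mx quad_norm_conj. Qed.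

End QuadraticExtension.

Section QuadraticExtensionDomain.
Variables (R : idomainType) (b : R).
Local Notation M := (quadext b).

Lemma det_norm_mul_eq0 n (A B : 'M[M]_n.+1) :
  A *m B = 0 -> det_norm A = 0 \/ det_norm B = 0.
Proof.
move=> AB0; have /eqP : det_norm A * det_norm B = 0.
  by rewrite -det_norm_mul AB0 /det_norm det0 quad_norm0.
by rewrite mulf_eq0 => /orP[]/eqP; [left | right].
Qed.

(** Both equations equate two products of matrices up to a scalar, so that
    [quad_norm_elim] applies to the determinants. *)
Lemma det_norm_quaternion (X Y X' Y' : 'M[M]_3) (e : M) :
  X *m X' + e *: (map_mx (@quad_conj _ _) Y *m Y') = 0 ->
  map_mx (@quad_conj _ _) X *m Y' + Y *m X' = 0 -> (e ^+ 3).2 != 0 ->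
  det_norm Y = 0 \/ det_norm Y' = 0.
Proof.
move/eqP; rewrite addr_eq0 -scaleNr => /eqP E1.
move/eqP; rewrite addr_eq0 -scaleN1r => /eqP E2 ne3.
have : det_norm Y * (det_norm Y' * (e ^+ 3).2) = 0.
  apply: (quad_norm_elim (x := \det X) (x' := \det X')).
    by rewrite -det_map_mx -!det_mulmx E1 detZ exprNn -signr_odd expr1 mulN1r.
  by rewrite -det_map_mx -!det_mulmx E2 detZ -signr_odd expr1 mulN1r.
by move/eqP; rewrite !mulf_eq0 (negPf ne3) orbF => /orP[]/eqP; [left | right].
Qed.

End QuadraticExtensionDomain.

(** * The regular representation of a cyclic algebra of degree 3 *)

Section CyclicRepresentation.
Variables (F : fieldType) (L : fieldExtType F) (sigma : 'AEnd(L)) (c : F).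
Hypothesis sigmaK3 : forall u, sigma (sigma (sigma u)) = u.
Local Notation D := (cyclic_alg 3 sigma c).

(** Left multiplication by x, in the basis 1, e, e^2 of the right L-module D.
    The difference k - j is taken modulo 3, and the factor c appears when the
    exponent of e wraps around. *)
Definition lmul_mx (x : D) : 'M[L]_3 :=
  \matrix_(k, j) (c%:A ^+ (k < j)%N * iter j sigma (x (k - j))).

(** This is the associativity of D, checked on the nine entries. *)
Lemma lmul_mxM (x y : D) : lmul_mx (na_mul x y) = lmul_mx x *m lmul_mx y.
Proof.
(* Indexing by nat lets the indices modulo 3 be computed. *)
pose X (z : D) (i : nat) : L := z (inord i).
have XE (z : D) (i : 'I_3) : z i = X z i by rewrite /X inord_val.
have mod3E := (erefl : (1 + 1 = 2)%N, erefl : (1 + 2 = 3)%N,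
  erefl : (2 + 1 = 3)%N, erefl : (2 + 2 = 4)%N, erefl : (3 - 0 = 3)%N,
  erefl : (3 - 1 = 2)%N, erefl : (3 - 2 = 1)%N, erefl : (0 %% 3 = 0)%N,
  erefl : (1 %% 3 = 1)%N, erefl : (2 %% 3 = 2)%N, erefl : (3 %% 3 = 0)%N,
  erefl : (4 %% 3 = 1)%N).
apply/matrixP=> k l; rewrite !mxE !ffunE.
under [RHS]eq_bigr => j _ do rewrite !mxE !XE /=.
under [in LHS]eq_bigr => i _.
  rewrite big_mkcond; under eq_bigr => j _ do rewrite !XE /=.
  over.
rewrite !(big_ord_recl, big_ord0) /= /bump /=.
have cE (u : L) : c *: u = c%:A * u by rewrite mulr_algl.
have sc : sigma c%:A = c%:A by exact: rmorph_alg.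
have sD (u v : L) : sigma (u + v) = sigma u + sigma v by exact: rmorphD.
have sM (u v : L) : sigma (u * v) = sigma u * sigma v by exact: rmorphM.
case: k => [[|[|[|//]]]] lk; case: l => [[|[|[|//]]]] ll;
  rewrite /= ?(add0n, addn0, addr0, add0r, expr0, expr1, mul1r) /=;
  rewrite !mod3E ?scale1r ?expr1;
  move: (X x 0%N) (X x 1%N) (X x 2%N) (X y 0%N) (X y 1%N) (X y 2%N) (c%:A : L)
    cE sc => x0 x1 x2 y0 y1 y2 a cE sc;
  rewrite ?cE ?sD ?sM ?sc ?sigmaK3 ?sD ?sM ?sc ?sigmaK3; ring.
Qed.

Let iter_sigmaP j k (u v : L) :
  iter j sigma (k *: u + v) = k *: iter j sigma u + iter j sigma v.
Proof. by elim: j => //= j ->; rewrite linearP. Qed.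

Lemma lmul_mxP k (x y : D) :
  lmul_mx (k *: x + y) = k%:A *: lmul_mx x + lmul_mx y.
Proof.
apply/matrixP=> i j; rewrite !mxE !ffunE iter_sigmaP mulrDr -scalerAr.
by rewrite mulr_algl.
Qed.

Lemma lmul_mxD (x y : D) : lmul_mx (x + y) = lmul_mx x + lmul_mx y.
Proof. by have := lmul_mxP 1 x y; rewrite !scale1r. Qed.

Lemma lmul_mx0 : lmul_mx 0 = 0.
Proof. by apply: (addrI (lmul_mx 0)); rewrite -lmul_mxD !addr0. Qed.

Lemma lmul_mxZ k (x : D) : lmul_mx (k *: x) = k%:A *: lmul_mx x.
Proof. by have := lmul_mxP k x 0; rewrite lmul_mx0 !addr0. Qed.

Lemma lmul_mx1 : lmul_mx (na_one D) = 1%:M.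
Proof.
have s0 j : iter j sigma 0 = 0 by elim: j => //= j ->; rewrite rmorph0.
have s1 j : iter j sigma 1 = 1 by elim: j => //= j ->; rewrite rmorph1.
apply/matrixP=> i j; rewrite !mxE ffunE subr_eq0.
by case: eqP => [->|_]; rewrite ?s0 ?s1 ?mulr0 // ltnn mulr1.
Qed.

Hypothesis divD : is_division_alg D.

Lemma det_lmul_mx_neq0 (x : D) : x != 0 -> \det (lmul_mx x) != 0.
Proof.
move=> /(divD.2 x)[[y _ xyK] _]; apply/eqP=> dx0.
have := lmul_mxM x (y (na_one D)); rewrite xyK lmul_mx1 => /(congr1 determinant).
by rewrite det1 det_mulmx dx0 mul0r => /eqP; rewrite oner_eq0.
Qed.

Variable b : F.
Hypothesis bNsquare : forall u : L, u ^+ 2 != b%:A.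

(** A square root w of b in D would give det(w)^2 = b^3, and the square of
    det(w)/b would be b. *)
Lemma cyclic_sqr_neq (w : D) : na_mul w w != b *: na_one D.
Proof.
have nzb : b%:A != 0 :> L.
  by have := bNsquare 0; rewrite expr0n eq_sym.
apply/eqP=> /(congr1 lmul_mx); rewrite lmul_mxM lmul_mxZ lmul_mx1.
move=> /(congr1 determinant); rewrite det_mulmx detZ det1 mulr1 => detE.
case/negP: (bNsquare (\det (lmul_mx w) / b%:A)); rewrite expr_div_n expr2 detE.
by apply/eqP; move: (b%:A : L) nzb => a nza; field.
Qed.

(** The extension of scalars of D by a square root s of b has no zero divisors.
    For y = 0 the norm is det(x)^2; otherwise x = y w, and multiplying
    y (w + s) by w - s yields y (w^2 - b), both factors of which are nonzero
    elements of D. *)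
Lemma det_norm_eq0 (x y : D) :
  det_norm (quad_mx b%:A (lmul_mx x) (lmul_mx y)) = 0 -> x = 0 /\ y = 0.
Proof.
have [-> | nzy] := eqVneq y 0.
  rewrite lmul_mx0 det_norm_in => /eqP; rewrite sqrf_eq0 => /eqP dx0.
  by split=> //; apply/eqP; apply: contra_eqT dx0 => /det_lmul_mx_neq0.
have [[h _ yhK] _] := divD.2 y nzy; have xE := yhK x.
pose w := h x; rewrite -/w in xE.
pose z : D := na_mul w w - b *: na_one D.
have nzz : z != 0 by rewrite subr_eq0 cyclic_sqr_neq.
have zE : quad_mx b%:A (lmul_mx w) 1%:M *m quad_mx b%:A (lmul_mx w) (- 1%:M)
          = quad_mx b%:A (lmul_mx z) 0.
  rewrite mul_quad_mx !(mulmxN, mulmx1, mul1mx).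
  rewrite [X in quad_mx _ _ X = _]addrC subrr; congr quad_mx.
  rewrite /z -scaleNr lmul_mxD lmul_mxM lmul_mxZ lmul_mx1.
  by rewrite scaleNr scaleNr scalerN.
rewrite -xE lmul_mxM -[in X in quad_mx _ _ X](mulmx1 (lmul_mx y)).
have -> : quad_mx b%:A (lmul_mx y *m lmul_mx w) (lmul_mx y *m 1%:M)
    = quad_mx b%:A (lmul_mx y) 0 *m quad_mx b%:A (lmul_mx w) 1%:M.
  by rewrite mul_quad_mx !mul0mx scaler0 !addr0.
move=> /(congr1 ( *%R^~ (det_norm (quad_mx b%:A (lmul_mx w) (- 1%:M))))).
rewrite -det_norm_mul -mulmxA zE det_norm_mul !det_norm_in mul0r => /eqP.
by rewrite mulf_eq0 !sqrf_eq0 !(negPf (det_lmul_mx_neq0 _)).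
Qed.

End CyclicRepresentation.

(** An automorphism of order dividing 3 sends a square root u of b to u, as
    u |-> - u has order 2; hence u lies in the fixed field F. *)
Lemma nonsquare_cubic (F : fieldType) (L : fieldExtType F) (sigma : 'AEnd(L))
    (b : F) :
  2%N \notin [pchar F] -> (forall u, sigma (sigma (sigma u)) = u) ->
  (forall u, sigma u = u -> u \in 1%VS) -> (forall q : F, q ^+ 2 != b) ->
  forall u : L, u ^+ 2 != b%:A.
Proof.
move=> nF2 sigmaK3 fixF bNsq u; apply/eqP=> uE.
have su2 : (sigma u) ^+ 2 = u ^+ 2 by rewrite -rmorphXn /= uE rmorph_alg.
have sN v : sigma (- v) = - sigma v by exact: rmorphN.
have su : sigma u = u.
  move/eqP: su2; rewrite eqf_sqr => /orP[/eqP // | /eqP su].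
  have : 2%:R *: u == 0.
    by rewrite scaler_nat mulr2n -{2}(sigmaK3 u) su sN su opprK su subrr.
  rewrite scaler_eq0 => /orP[n2|/eqP->]; last exact: rmorph0.
  by rewrite inE n2 in nF2.
have /vlineP[q uq] := fixF u su; case/eqP: (bNsq q).
by apply: (fmorph_inj (in_alg L)); rewrite rmorphXn /= -uE uq.
Qed.

(** * Coordinates in a quadratic field extension *)

Section QuadraticField.
Variables (F : fieldType) (K : fieldExtType F) (b : F) (r : K) (tau : 'AEnd(K)).
Hypotheses (dimK : \dim {:K} = 2%N) (r2 : r ^+ 2 = b%:A)
  (genK : <<1; r>>%VS = {:K}%VS) (tau_r : tau r = - r).

Lemma gen_quadratic_notin1 : r \notin 1%VS.
Proof.
by apply/negP=> /Fadjoin_idP; rewrite genK => K1; have := dimK; rewrite K1 dimv1.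
Qed.

Lemma quadratic_nonsquare q : q ^+ 2 != b.
Proof.
apply/eqP=> qb; case/negP: gen_quadratic_notin1; apply/vlineP.
have : r ^+ 2 == (q%:A) ^+ 2.
  by apply/eqP; rewrite r2 -qb [LHS](rmorphXn (in_alg K)).
rewrite eqf_sqr => /orP[] /eqP->; [by exists q | exists (- q)].
by rewrite scaleNr.
Qed.

Lemma quadratic_basis : basis_of {:K} [tuple r; 1].
Proof.
rewrite basisEfree subvf dimK /= andbT free_cons span_seq1 gen_quadratic_notin1.
by rewrite seq1_free oner_neq0.
Qed.

Definition coef_r : {linear K -> F^o} := coord [tuple r; 1] ord0.
Definition coef_1 : {linear K -> F^o} := coord [tuple r; 1] ord_max.

Lemma quadraticE x : x = (coef_1 x)%:A + coef_r x *: r.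
Proof.
rewrite [LHS](coord_basis quadratic_basis) ?memvf // !big_ord_recl big_ord0 /=.
rewrite addr0 addrC; congr (coord _ _ _ *: _ + _); exact: val_inj.
Qed.

Lemma coefsP x p q : x = p%:A + q *: r -> coef_1 x = p /\ coef_r x = q.
Proof.
have fB := basis_free quadratic_basis.
have c11 : coef_1 1 = 1 := coord_free ord_max ord_max fB.
have cr1 : coef_r 1 = 0 := coord_free ord_max ord0 fB.
have c1r : coef_1 r = 0 := coord_free ord0 ord_max fB.
have crr : coef_r r = 1 := coord_free ord0 ord0 fB.
move=> ->; rewrite !linearD !linearZ /= c11 cr1 c1r crr /GRing.scale /=.
by rewrite !mulr0 !mulr1 addr0 add0r.
Qed.

Variable L : fieldExtType F.
(** The embedding of K = F(r) into L[s]/(s^2 - b) that sends r to s. *)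
Definition quad_emb (x : K) : quadext (b%:A : L) := ((coef_1 x)%:A, (coef_r x)%:A).

Lemma quad_embD x y : quad_emb (x + y) = quad_emb x + quad_emb y.
Proof. by congr (_, _); rewrite linearD scalerDl. Qed.

Lemma quad_embM x y : quad_emb (x * y) = quad_emb x * quad_emb y.
Proof.
have [] := @coefsP (x * y) (coef_1 x * coef_1 y + b * (coef_r x * coef_r y))
  (coef_1 x * coef_r y + coef_r x * coef_1 y).
  rewrite [in LHS](quadraticE x) [in LHS](quadraticE y).
  rewrite mulrDl !mulrDr -!scalerAl -!scalerAr !mul1r ?mulr1 -expr2 r2.
  rewrite !scalerA !scalerDl [_ * b]mulrC.
  by rewrite [X in _ + X]addrC addrACA [X in _ + X]addrC.
rewrite /quad_emb => -> ->; congr (_, _) => /=;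
  rewrite !scalerDl -!scalerAl !mul1r !scalerA //.
by rewrite mulrA.
Qed.

Lemma quad_emb_tau x : quad_emb (tau x) = quad_conj (quad_emb x).
Proof.
have [] := @coefsP (tau x) (coef_1 x) (- coef_r x).
  rewrite [in LHS](quadraticE x) rmorphD /= rmorph_alg linearZ /= tau_r.
  by rewrite scalerN scaleNr.
by rewrite /quad_emb => -> ->; rewrite scaleNr.
Qed.
End QuadraticField.

(** The exponent 3 is that of the determinant of a scalar 3 x 3 matrix. *)
Lemma quad_emb_cube (F : fieldType) (K L : fieldExtType F) (b : F) (r : K) d0 d1 :
  \dim {:K} = 2%N -> r ^+ 2 = b%:A -> <<1; r>>%VS = {:K}%VS ->
  (quad_emb b r L (d0%:A + d1 *: r) ^+ 3).2 =
  (d1 * (3 * d0 ^+ 2 + b * d1 ^+ 2))%:A.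
Proof.
move=> dimK r2 genK.
have [d0E d1E] := @coefsP _ _ r dimK genK (d0%:A + d1 *: r) d0 d1 erefl.
rewrite /quad_emb d0E d1E !exprS expr0 mulr1 !quadextM /=.
rewrite -[RHS]/(in_alg L _) !(rmorphM, rmorphD, rmorphXn, rmorph_nat) /=.
by move: (d0%:A : L) (d1%:A : L) (b%:A : L) => a0 a1 a2; ring.
Qed.

(** * Tensor product of a cyclic and a quaternion algebra *)

Section Tensor.
Variables (F : fieldType) (K L : fieldExtType F) (b : F) (r : K) (tau : 'AEnd(K)).
Variables (sigma : 'AEnd(L)) (c : F) (d : K).
Hypotheses (dimK : \dim {:K} = 2%N) (r2 : r ^+ 2 = b%:A)
  (genK : <<1; r>>%VS = {:K}%VS) (tau_r : tau r = - r).
Hypothesis sigmaK3 : forall u, sigma (sigma (sigma u)) = u.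
Local Notation D := (cyclic_alg 3 sigma c).
Local Notation Q := (quaternion_alg tau d).
Local Notation M := (quadext (b%:A : L)).
Local Notation rho := (@lmul_mx F L sigma c).
Local Notation phi := (@quad_emb F K b r L).

(** For p one of the two projections of Q = K + e K on K, the matrix of the
    component in D (x) K of a tensor, with K embedded into M by phi. *)
Definition coef_mx (p : {linear Q -> K}) (t : tens_alg D Q) : 'M[M]_3 :=
  quad_mx (b%:A : L) (rho (contraction (coef_1 r \o p) t))
                     (rho (contraction (coef_r r \o p) t)).

Lemma coef_mxD p s t : coef_mx p (s + t) = coef_mx p s + coef_mx p t.
Proof. by rewrite /coef_mx !contractionD !lmul_mxD quad_mxD. Qed.

Lemma coef_mx_pure p (a : D) (v : Q) :
  coef_mx p (tens_pure a v) = phi (p v) *: map_mx (@quad_in _ _) (rho a).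
Proof.
rewrite /coef_mx !contraction_pure /= !lmul_mxZ.
apply/matrixP=> i j; rewrite !mxE quadextM /=.
by rewrite !mulr0 addr0 add0r.
Qed.

Lemma tens_contractionE (t : tens_alg D Q) :
  t = tens_pure (contraction (coef_1 r \o fst) t) ((1, 0) : Q)
    + tens_pure (contraction (coef_r r \o fst) t) ((r, 0) : Q)
    + tens_pure (contraction (coef_1 r \o snd) t) ((0, 1) : Q)
    + tens_pure (contraction (coef_r r \o snd) t) ((0, r) : Q).
Proof.
elim/tens_pure_ind: t => [a v | s t IHs IHt].
  rewrite !contraction_pure !tens_pureZl -!tens_pureZr -!tens_pureDr.
  congr tens_pure; case: v => x y.
  by congr (_, _) => /=; rewrite !scaler0 ?addr0 ?add0r -quadraticE.
rewrite !contractionD !tens_pureDl.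
rewrite [in LHS]IHs [in LHS]IHt addrACA; congr (_ + _).
rewrite addrACA; congr (_ + _); exact: addrACA.
Qed.

Let X := coef_mx fst.
Let Y := coef_mx snd.

(** The product of D (x) Q in the form (x + e y) (x' + e y').  All terms are
    additive in both factors, hence pure tensors suffice. *)
Lemma coef_mxM (s t : tens_alg D Q) :
  X (na_mul s t) = X s *m X t + phi d *: (map_mx (@quad_conj _ _) (Y s) *m Y t)
  /\ Y (na_mul s t) = map_mx (@quad_conj _ _) (X s) *m Y t + Y s *m X t.
Proof.
have [ml mr] := na_mul_bilinear (tens_alg D Q).
have mD (u v w : tens_alg D Q) : na_mul (u + v) w = na_mul u w + na_mul v w.
  by have /= := ml w 1 u v; rewrite !scale1r.
have mDr (u v w : tens_alg D Q) : na_mul w (u + v) = na_mul w u + na_mul w v.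
  by have /= := mr w 1 u v; rewrite !scale1r.
have XD : {morph X : u v / u + v} := @coef_mxD fst.
have YD : {morph Y : u v / u + v} := @coef_mxD snd.
elim/tens_pure_ind: s => [a u | s s' [Xs Ys] [Xs' Ys']]; last first.
  rewrite (mD s s' t) !(XD s s') !(YD s s') XD YD.
  rewrite Xs Ys Xs' Ys'; move: (X s) (X s') (Y s) (Y s') (X t) (Y t) (phi d).
  clear=> x x' y y' x1 y1 e.
  by rewrite !map_mxD !mulmxDl scalerDr; split; rewrite addrACA.
elim/tens_pure_ind: t => [a' u' | t t' [Xt Yt] [Xt' Yt']]; last first.
  rewrite (mDr t t') !(XD t t') !(YD t t') XD YD.
  rewrite Xt Yt Xt' Yt'; move: (X t) (X t') (Y t) (Y t') (X _) (Y _) (phi d).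
  clear=> x x' y y' x1 y1 e.
  by rewrite !mulmxDr scalerDr; split; rewrite addrACA.
rewrite [na_mul _ _]tens_mul_pure /X /Y !coef_mx_pure /=.
have conjA : map_mx (@quad_conj _ _) (map_mx (@quad_in _ (b%:A : L)) (rho a))
    = map_mx (@quad_in _ _) (rho a).
  by apply/matrixP=> i j; rewrite !mxE /quad_conj /= oppr0.
rewrite lmul_mxM // map_mxM /= !map_mxZ /= conjA.
rewrite !(quad_embD, quad_embM dimK r2 genK) !(quad_emb_tau _ dimK genK tau_r).
move: (map_mx _ _) (map_mx _ _) (phi _) (phi _) (phi _) (phi _) (phi _).
clear=> A A' e1 e2 e3 e4 e5.
by rewrite -!scalemxAl -!scalemxAr !scalerA -!scalerDl.
Qed.

Hypothesis divD : is_division_alg D.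
Hypothesis bNsquare : forall u : L, u ^+ 2 != b%:A.

Lemma det_norm_coef_mx_eq0 p (t : tens_alg D Q) :
  det_norm (coef_mx p t) = 0 ->
  contraction (coef_1 r \o p) t = 0 /\ contraction (coef_r r \o p) t = 0.
Proof. exact: det_norm_eq0. Qed.

Lemma det_norm_eq0_coef_mx p (t : tens_alg D Q) :
  det_norm (coef_mx p t) = 0 -> coef_mx p t = 0.
Proof.
case/det_norm_coef_mx_eq0=> t1 tr; rewrite /coef_mx t1 tr lmul_mx0.
by apply/matrixP=> i j; rewrite !mxE.
Qed.

Lemma tens_eq0 (t : tens_alg D Q) :
  det_norm (X t) = 0 -> det_norm (Y t) = 0 -> t = 0.
Proof.
move=> /det_norm_coef_mx_eq0[X1 Xr] /det_norm_coef_mx_eq0[Y1 Yr].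
by rewrite (tens_contractionE t) X1 Xr Y1 Yr !tens_pure0l !addr0.
Qed.

Hypothesis dcubeN : (phi d ^+ 3).2 != 0.

(** By [det_norm_quaternion] the matrix Y vanishes at s or at t.  What remains of
    the two components of s t = 0 says that two products of matrices vanish, and
    a factor of norm zero is zero. *)
Lemma tens_domain (s t : tens_alg D Q) : na_mul s t = 0 -> s = 0 \/ t = 0.
Proof.
have [XM YM] := coef_mxM s t; move=> st0.
have X0 : X 0 = 0 by apply: (addrI (X 0)); rewrite -coef_mxD !addr0.
have Y0 : Y 0 = 0 by apply: (addrI (Y 0)); rewrite -coef_mxD !addr0.
rewrite st0 X0 in XM; rewrite st0 Y0 in YM.
have [Ys0 | Yt0] := det_norm_quaternion (esym XM) (esym YM) dcubeN.
  have YsE : Y s = 0 := det_norm_eq0_coef_mx Ys0.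
  rewrite YsE map_mx0 mul0mx scaler0 addr0 in XM.
  rewrite YsE mul0mx addr0 in YM.
  have [Xs0 | Xt0] := det_norm_mul_eq0 (esym XM).
    left; exact: (tens_eq0 Xs0 Ys0).
  have [Xs0 | Yt0] := det_norm_mul_eq0 (esym YM).
    rewrite det_norm_conj in Xs0; left; exact: (tens_eq0 Xs0 Ys0).
  right; exact: (tens_eq0 Xt0 Yt0).
have YtE : Y t = 0 := det_norm_eq0_coef_mx Yt0.
rewrite YtE mulmx0 scaler0 addr0 in XM.
rewrite YtE mulmx0 add0r in YM.
have [Xs0 | Xt0] := det_norm_mul_eq0 (esym XM).
  have [Ys0 | Xt0] := det_norm_mul_eq0 (esym YM).
    left; exact: (tens_eq0 Xs0 Ys0).
  right; exact: (tens_eq0 Xt0 Yt0).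
right; exact: (tens_eq0 Xt0 Yt0).
Qed.

Lemma tens_division : is_division_alg (tens_alg D Q).
Proof.
apply: division_alg_of_domain tens_domain; have [[x nzx] _] := divD.
exists (tens_pure x (1, 0) : tens_space D Q); apply: contraNneq nzx => x0.
have [one1 _] : coef_1 r 1 = 1 /\ coef_r r 1 = 0.
  by apply: (coefsP dimK genK); rewrite scale1r scale0r addr0.
have := contraction_pure (coef_1 r \o fst : {linear Q -> F^o}) x ((1, 0) : Q).
by rewrite /= one1 scale1r x0 /contraction linear0 => <-.
Qed.

End Tensor.

(** The first claim.  A generator sigma of a Galois group of order 3 satisfies
    sigma^3 = 1 and its fixed elements are the scalars; d1 is not zero as d is
    not a scalar. *)
Lemma cyclic_quaternion_division (F0 : fieldType) (b : F0)
    (F : fieldExtType F0) (sqrtb : F) (tau : 'AEnd(F))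
    (L : splittingFieldType F0) (sigma : gal_of {:L}%VS)
    (c : F0) (d : F) (d0 d1 : F0) :
    (2%N \notin [pchar F0]) ->
    \dim {:F} = 2%N -> sqrtb ^+ 2 = b%:A -> <<1; sqrtb>>%VS = {:F}%VS ->
    tau sqrtb = - sqrtb ->
    \dim {:L} = 3%N -> galois 1 {:L} -> 'Gal({:L} / 1)%g = <[sigma]>%g ->
    is_division_alg (cyclic_alg 3 sigma c) ->
    d = d0%:A + sqrtb * d1%:A -> d \notin 1%VS ->
    3 * d0 ^+ 2 + b * d1 ^+ 2 != 0 ->
    is_division_alg
      (tens_alg (cyclic_alg 3 sigma c) (quaternion_alg tau d)).
Proof.
move=> nF2 dimF r2 genF tau_r dimL galL genG divD dE dN1 dcube.
have oG : #[sigma]%g = 3%N.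
  by rewrite orderE -genG -(galois_dim galL) dimv1 divn1 dimL.
have sigmaK3 u : sigma (sigma (sigma u)) = u.
  have := expg_order sigma; rewrite oG => s3.
  have := gal_id {:L} u; rewrite -s3 !expgS expg0 mulg1.
  by rewrite !galM ?memvf.
have fixS u : sigma u = u -> u \in 1%VS.
  move=> su; rewrite -(galois_fixedField galL).
  apply/fixedFieldP; first exact: memvf.
  rewrite genG => x /cycleP[i ->]; elim: i => [|i IHi]; first by rewrite expg0 gal_id.
  by rewrite expgS galM ?memvf // su.
apply: (@tens_division F0 F L b sqrtb tau sigma c d) => //.
  exact: (nonsquare_cubic nF2 sigmaK3 fixS (quadratic_nonsquare dimF r2 genF)).
have dE' : d = d0%:A + d1 *: sqrtb by rewrite dE mulr_algr.
rewrite dE' quad_emb_cube // scaler_eq0 oner_eq0 orbF mulf_eq0 (negPf dcube) orbF.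
apply: contraNneq dN1 => d10; rewrite dE' d10 scale0r addr0.
by apply/vlineP; exists d0.
Qed.

Theorem theorem18 :
  (forall (F0 : fieldType) (b : F0) (F : fieldExtType F0) (sqrtb : F)
     (tau : 'AEnd(F)) (L : splittingFieldType F0) (sigma : gal_of {:L}%VS)
     (c : F0) (d : F) (d0 d1 : F0),
     (2%N \notin [pchar F0]) ->
     \dim {:F} = 2%N -> sqrtb ^+ 2 = b%:A -> <<1; sqrtb>>%VS = {:F}%VS ->
     tau sqrtb = - sqrtb ->
     \dim {:L} = 3%N -> galois 1 {:L} -> 'Gal({:L} / 1)%g = <[sigma]>%g ->
     c != 0 -> is_division_alg (cyclic_alg 3 sigma c) ->
     d = d0%:A + sqrtb * d1%:A -> d \notin 1%VS ->
     3 * d0 ^+ 2 + b * d1 ^+ 2 != 0 ->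
     is_division_alg
       (tens_alg (cyclic_alg 3 sigma c) (quaternion_alg tau d)))
  /\
  (forall (b : rat) (F : fieldExtType rat) (sqrtb : F)
     (tau : 'AEnd(F)) (L : splittingFieldType rat) (sigma : gal_of {:L}%VS)
     (c : rat) (d : F) (d0 d1 : rat),
     \dim {:F} = 2%N -> sqrtb ^+ 2 = b%:A -> <<1; sqrtb>>%VS = {:F}%VS ->
     tau sqrtb = - sqrtb ->
     \dim {:L} = 3%N -> galois 1 {:L} -> 'Gal({:L} / 1)%g = <[sigma]>%g ->
     c != 0 -> is_division_alg (cyclic_alg 3 sigma c) ->
     d = d0%:A + sqrtb * d1%:A -> d \notin 1%VS ->
     (0 < b \/ (b < 0 /\ ~ exists2 q : rat, q != 0 & - (b / 3) = q ^+ 2)) ->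
     is_division_alg
       (tens_alg (cyclic_alg 3 sigma c) (quaternion_alg tau d))).
Proof.
split=> [F0 b F sqrtb tau L sigma c d d0 d1 nF2 dimF r2 genF tau_r dimL galL genG
          _ divD dE dN1 dcube
        |b F sqrtb tau L sigma c d d0 d1 dimF r2 genF tau_r dimL galL genG
          _ divD dE dN1 bP].
  exact: (cyclic_quaternion_division nF2 dimF r2 genF tau_r dimL galL genG divD
    dE dN1 dcube).
have nQ2 : 2%N \notin [pchar rat] by rewrite pchar_num.
apply: (cyclic_quaternion_division nQ2 dimF r2 genF tau_r dimL galL genG divD
  dE dN1).
have nzd1 : d1 != 0.
  apply: contraNneq dN1 => d10; rewrite dE d10 scale0r mulr0 addr0.
  by apply/vlineP; exists d0.
apply/eqP=> E; have bE : - (b / 3) = (d0 / d1) ^+ 2.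
  have -> : b = - (3 * d0 ^+ 2) / d1 ^+ 2.
    have /eqP := E; rewrite addrC addr_eq0 => /eqP <-.
    by rewrite mulfK // expf_neq0.
  by field.
case: bP => [b_gt0 | [b_lt0 nsq]].
  have := sqr_ge0 (d0 / d1); rewrite -bE oppr_ge0 leNgt.
  by rewrite divr_gt0.
apply: nsq; exists (d0 / d1) => //; apply/eqP=> q0.
move: bE b_lt0; rewrite q0 expr0n /= => /eqP.
by rewrite oppr_eq0 mulf_eq0 invr_eq0 orbF => /eqP->; rewrite ltxx.
Qed.
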